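(* Let $(A_t)_{t=1}^\infty$ be an adapted sequence of events in a filtered probability space, let $A_\infty=\limsup_{t\to\infty}A_t$, and let $\alpha\in(0,1)$. The following are equivalent: (a) $\mathbb{P}\left(\bigcup_{t=1}^\infty A_t\right)\le\alpha$. (b) $\mathbb{P}(A_T)\le\alpha$ for all random (not necessarily stopping) times $T$. (c) $\mathbb{P}(A_\tau)\le\alpha$ for all stopping times $\tau$, possibly infinite.
   Context: Random times and stopping times take values in $\{1,2,\dots\}\cup\{\infty\}$. For such a time $T$, $A_T$ is the event $\left(\bigcup_{t=1}^\infty(A_t\cap\{T=t\})\right)\cup(A_\infty\cap\{T=\infty\})$. Adapted means $A_t\in\mathcal F_t$ for each $t$. $\limsup_tA_t=\bigcap_{n}\bigcup_{t\ge n}A_t$. *)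

(* Defs.v *)
From HB Require Import structures.
From mathcomp Require Export all_boot all_order all_algebra.
From mathcomp Require Export all_classical all_reals all_analysis.

Set Implicit Arguments.
Unset Strict Implicit.
Unset Printing Implicit Defensive.
Import Order.TTheory GRing.Theory Num.Theory.
Local Open Scope classical_set_scope.

(* Time runs over 1, 2, ...: families indexed by t : nat are only constrained,
   and only used, at t >= 1; their value at 0 is junk.
   lim_sup_set A is also insensitive to A 0, as its n = 1 term is contained in
   its n = 0 term. *)

Definition filtration d (Omega : measurableType d)
    (F : nat -> set (set Omega)) : Prop :=
  [/\ forall t, 1 <= t -> sigma_algebra [set: Omega] (F t),
      forall t, 1 <= t -> F t `<=` measurable &
      forall s t, 1 <= s -> s <= t -> F s `<=` F t].

Definition adapted (Omega : Type) (F : nat -> set (set Omega))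
    (A : nat -> set Omega) : Prop :=
  forall t, 1 <= t -> F t (A t).

(* Some t is the finite time t, None is the infinite time; the value Some 0
   is excluded because times lie in {1, 2, ...} together with infinity. *)
Definition time_valued (Omega : Type) (T : Omega -> option nat) : Prop :=
  forall w, T w <> Some 0.

(* Measurability with respect to the discrete sigma-algebra on the countable
   set of times; u ranges over finite times and infinity. *)
Definition random_time d (Omega : measurableType d)
    (T : Omega -> option nat) : Prop :=
  time_valued T /\ forall u : option nat, measurable [set w | T w = u].

Definition stopping_time (Omega : Type) (F : nat -> set (set Omega))
    (tau : Omega -> option nat) : Prop :=
  time_valued tau /\
  forall t, 1 <= t -> F t [set w | exists2 s, tau w = Some s & s <= t].

(* The event A_T, where Ainf is the event attached to the infinite time. *)
Definition event_at (Omega : Type) (A : nat -> set Omega) (Ainf : set Omega)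
    (T : Omega -> option nat) : set Omega :=
  (\bigcup_(t >= 1) (A t `&` [set w | T w = Some t]))
    `|` (Ainf `&` [set w | T w = None]).

(* Main.v *)
(* (a) => (b): A_T lies in the union of the A_t, since limsup A_t does.
   (c) => (a): the first time tau at which some A_t occurs is a stopping time,
   and A_tau contains the union of the A_t. *)
Require Import Defs.

Set Implicit Arguments.
Unset Strict Implicit.
Unset Printing Implicit Defensive.
Import Order.TTheory GRing.Theory Num.Theory.
Local Open Scope classical_set_scope.
Local Open Scope ring_scope.

(** Write [U] for the union of the [A t] over [t >= 1]. Among all events [A_T], the largest is [U],
    and a stopping time attains it: [event_at_sub_bigcup] bounds every [A_T] by [U], and
    [first_occurrence_stopping_time] gives the reverse inclusion for the first occurrence. Since
    stopping times are random times ([stopping_time_random_time]), the three bounds follow from one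
    another in a cycle by monotonicity of [P]. *)

Lemma event_at_sub_bigcup (Omega : Type) (A : nat -> set Omega)
    (T : Omega -> option nat) :
  event_at A (lim_sup_set A) T `<=` \bigcup_(t >= 1%N) A t.
Proof.
by move=> w [[t t1 [At _]]|[limA _]]; [exists t | exact: (limA 1%N)].
Qed.

Lemma bigcup_ge1_measurable d (Omega : measurableType d)
    (F : nat -> set (set Omega)) (A : nat -> set Omega) :
  filtration F -> adapted F A -> measurable (\bigcup_(t >= 1%N) A t).
Proof.
move=> [_ Fm _] hA; apply: bigcup_measurable => t t1.
exact: Fm (hA t t1).
Qed.

(** Needed because monotonicity of [P] is applied to measurable events only. *)
Lemma event_at_measurable d (Omega : measurableType d)
    (F : nat -> set (set Omega)) (A : nat -> set Omega)
    (T : Omega -> option nat) :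
  filtration F -> adapted F A -> random_time T ->
  measurable (event_at A (lim_sup_set A) T).
Proof.
move=> [_ Fm _] hA [_ Tm].
have Am t : (1 <= t)%N -> measurable (A t) by move=> t1; exact: Fm (hA t t1).
have limE : lim_sup_set A = \bigcap_n \bigcup_(t >= n.+1) A t.
  apply/seteqP; split=> w limA n _; first exact: (limA n.+1).
  by have [t /ltnW nt At] := limA n I; exists t.
apply: measurableU.
  by apply: bigcup_measurable => t t1; apply: measurableI; [exact: Am|].
apply: measurableI => //; rewrite limE; apply: bigcap_measurable => // n _.
by apply: bigcup_measurable => t nt; apply: Am; exact: leq_trans nt.
Qed.

(** The level sets of [tau] come from the sublevel sets [L t]: a finite level is a difference of two
    consecutive ones, and the infinite level is the complement of their union. *)
Lemma stopping_time_random_time d (Omega : measurableType d)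
    (F : nat -> set (set Omega)) (tau : Omega -> option nat) :
  filtration F -> stopping_time F tau -> random_time tau.
Proof.
move=> [_ Fm _] [tau0 tauF]; split=> //.
pose L t := [set w | exists2 s, tau w = Some s & (s <= t)%N].
have Lm t : measurable (L t).
  (* [F 0] is unconstrained, but [L 0] is empty since [tau] never takes the value 0. *)
  case: t => [|t]; last exact: Fm (tauF t.+1 _).
  suff -> : L 0%N = set0 by [].
  by apply/seteqP; split=> w //= [s ws]; rewrite leqn0 => /eqP s0;
    apply: (tau0 w); rewrite ws s0.
case=> [[|t]|].
- suff -> : [set w | tau w = Some 0%N] = set0 by [].
  by apply/seteqP; split=> w // /tau0.
- suff -> : [set w | tau w = Some t.+1] = L t.+1 `\` L t
    by apply: measurableD.
  apply/seteqP; split=> w /=.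
    by move=> wt; split; [exists t.+1 | case=> s; rewrite wt => -[<-]; rewrite ltnn].
  move=> [[s ws st] nL]; rewrite ws; congr Some; apply/eqP.
  by rewrite eqn_leq st ltnNge; apply/negP => st'; apply: nL; exists s.
- suff -> : [set w | tau w = None] = ~` \bigcup_t L t
    by apply: measurableC; apply: bigcup_measurable.
  apply/seteqP; split=> w /=.
    by move=> w0 [t _ [s]]; rewrite w0.
  case ws: (tau w) => [s|//] nL; exfalso.
  by apply: nL; exists s => //; exists s.
Qed.

(** Take for [tau] the least [t >= 1] with [A t], or [None] if there is none. Then [tau <= t]
    exactly on the union of [A 1], ..., [A t], which lies in [F t]. On the union of all [A t] the
    time is finite, so [Ainf] can be arbitrary. *)
Lemma first_occurrence_stopping_time d (Omega : measurableType d)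
    (F : nat -> set (set Omega)) (A : nat -> set Omega) :
  filtration F -> adapted F A ->
  exists2 tau, stopping_time F tau &
    forall Ainf, \bigcup_(t >= 1%N) A t `<=` event_at A Ainf tau.
Proof.
move=> [Fs _ Fmono] hA.
have first w : exists u : option nat,
    if u is Some t then
      [/\ (1 <= t)%N, A t w &
          forall s, (1 <= s)%N -> A s w -> (t <= s)%N]
    else forall t, (1 <= t)%N -> ~ A t w.
  have [[t t1 At]|nA] := pselect (exists2 t, (1 <= t)%N & A t w); last first.
    by exists None => t t1 At; apply: nA; exists t.
  have ex : exists t, (1 <= t)%N && `[< A t w >].
    by exists t; rewrite t1; exact/asboolP.
  exists (Some (ex_minn ex)); case: ex_minnP => m /andP[m1 /asboolP Am] mmin.
  by split=> // s s1 As; apply: mmin; rewrite s1; exact/asboolP.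
have [tau tauP] := choice first; exists tau.
- split=> [w w0|t t1]; first by have := tauP w; rewrite w0 => -[].
  have [F0 _ FU] := Fs t t1.
  (* The finite union is padded with empty sets to use closure of [F t] under countable unions. *)
  suff -> : [set w | exists2 s, tau w = Some s & (s <= t)%N] =
      \bigcup_s (if (1 <= s <= t)%N then A s else set0).
    apply: FU => s; case: ifP => [/andP[s1 st]|//].
    exact: Fmono s1 st _ (hA s s1).
  apply/seteqP; split=> w /=.
    move=> [s ws st]; have := tauP w; rewrite ws => -[s1 As _].
    by exists s => //; rewrite s1 st.
  move=> [s _]; case: ifP => [/andP[s1 st] As|//].
  have := tauP w; case: (tau w) => [m [_ _ mmin]|/(_ s s1)//].
  by exists m => //; exact: leq_trans (mmin s s1 As) st.
- move=> Ainf w [t t1 At]; left; have := tauP w.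
  by case ws: (tau w) => [m|] => [[m1 Am _]|/(_ t t1)//]; exists m.
Qed.

Theorem lemma3 (R : realType) (d : measure_display) (Omega : measurableType d)
  (P : probability Omega R) (F : nat -> set (set Omega))
  (A : nat -> set Omega) (alpha : R)
  (hF : filtration F) (hA : adapted F A) (halpha : 0 < alpha < 1) :
  [<-> (P (\bigcup_(t >= 1%N) A t) <= alpha%:E)%E;
       forall T : Omega -> option nat, random_time T ->
         (P (event_at A (lim_sup_set A) T) <= alpha%:E)%E;
       forall tau : Omega -> option nat, stopping_time F tau ->
         (P (event_at A (lim_sup_set A) tau) <= alpha%:E)%E ].
Proof.
have Um := bigcup_ge1_measurable hF hA.
tfae.
- move=> PU T rT; apply: le_trans PU.
  apply: le_measure; rewrite ?inE //; last exact: event_at_sub_bigcup.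
  exact: event_at_measurable hF hA rT.
- by move=> PT tau /(stopping_time_random_time hF)/PT.
(* The bound at this single [tau] suffices, as [A_tau] contains the whole union. *)
- move=> Ptau; have [tau stau sub] := first_occurrence_stopping_time hF hA.
  apply: le_trans (Ptau tau stau); apply: le_measure; rewrite ?inE //.
  exact: event_at_measurable hF hA (stopping_time_random_time hF stau).
Qed.
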